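(* Let $1\to C\to\tilde G\to G\to 1$ be a central extension of groups such that $C$ is isomorphic to $\mathbf{Z}$ and contained in the derived subgroup of $\tilde G$. Assume that $\tilde G$ is finitely generated and equipped with a word metric, with word length $|\cdot|_{\tilde G}$. Let $(\Omega,\nu)$ be a standard probability space on which $\tilde G$ acts by measure-preserving automorphisms. Let $1\le p<\infty$ and let $\pi$ be the corresponding norm-preserving representation of $\tilde G$ on $L^p(\Omega,\nu)$. Then every $1$-cocycle $b\in Z^1(\tilde G,\pi)$ is sublinear in restriction to the central subgroup $C$: $$\frac{\|b(c)\|}{|c|_{\tilde G}}\to 0\quad\text{as } c\in C \text{ and } |c|_{\tilde G}\to\infty .$$
   Context: The representation $\pi$ is given by $(\pi(g)\phi)(\omega)=\phi(g^{-1}\omega)$. $Z^1(\tilde G,\pi)$ is the set of $1$-cocycles, i.e. maps $b:\tilde G\to L^p(\Omega,\nu)$ with $b(gh)=b(g)+\pi(g)b(h)$ for all $g,h\in\tilde G$. A central extension is a short exact sequence in which $C$ is contained in the center of $\tilde G$. *)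

(* Defs.v *)
From HB Require Import structures.
From mathcomp Require Import all_boot all_order all_algebra.
From mathcomp Require Import all_classical all_reals all_analysis.
From mathcomp Require Import measurable_realfun.
Set Implicit Arguments.
Unset Strict Implicit.
Unset Printing Implicit Defensive.
Import Order.TTheory GRing.Theory Num.Theory.
Import numFieldNormedType.Exports.
Local Open Scope classical_set_scope.
Local Open Scope ring_scope.

Section Groups.
Local Open Scope group_scope.

Record central_extension (C E G : groupType)
    (i : {multiplicative C -> E}) (q : {multiplicative E -> G}) : Prop := {
  cext_inj : injective i;
  cext_surj : forall y : G, exists x : E, q x = y;
  cext_exact : forall x : E, q x = 1 <-> exists c : C, i c = x;
  cext_central : forall (c : C) (x : E), commute (i c) x
}.

Definition isomorphic_to_Z (C : groupType) : Prop :=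
  exists2 f : int -> C, bijective f & {morph f : m n / (m + n)%R >-> m * n}.

(* [S : {pred G}] ranges over all subsets of [G], since membership is
   decidable classically; the library's generated groups are finite. *)
Definition generated_subgroup (G : groupType) (A : set G) : set G :=
  [set x | forall S : {pred G}, group_closed S ->
     (forall a, A a -> a \in S) -> x \in S].

Definition derived_subgroup (G : groupType) : set G :=
  generated_subgroup [set z : G | exists x y, z = [~ x, y]].

Definition generates (G : groupType) (S : seq G) : Prop :=
  generated_subgroup [set` S] = [set: G].

Definition is_word (G : groupType) (S : seq G) (w : seq G) : bool :=
  all (fun x => (x \in S) || (x^-1 \in S)) w.

Definition spelled_in (G : groupType) (S : seq G) (g : G) : pred nat :=
  fun n => `[< exists w : seq G,
    [/\ is_word S w, size w = n & g = \prod_(x <- w) x] >].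

Lemma spelled_in_ex (G : groupType) (S : seq G) (genS : generates S) (g : G) :
  exists n, spelled_in S g n.
Proof.
pose P : {pred G} := fun x => `[< exists w, is_word S w /\ x = \prod_(y <- w) y >].
suff /asboolP[w [wS gw]] : g \in P.
  by exists (size w); apply/asboolP; exists w.
have : generated_subgroup [set` S] g by rewrite genS.
apply=> [|a /= aS].
- split; first by apply/asboolP; exists [::]; rewrite big_nil.
  move=> x y /asboolP[v [vS ->]] /asboolP[w [wS ->]]; apply/asboolP.
  exists (v ++ rev (map (fun z => z^-1) w)); split.
    rewrite /is_word all_cat; apply/andP; split; first exact: vS.
    rewrite all_rev all_map; apply: sub_all wS => z /=.
    by rewrite invgK orbC.
  rewrite big_cat; congr (_ * _).
  elim: w {wS} => [|z w IH]; first by rewrite !big_nil invg1.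
  by rewrite big_cons invgM IH /= rev_cons -cats1 big_cat big_seq1.
- apply/asboolP; exists [:: a]; rewrite big_seq1; split=> //.
  by rewrite /is_word /= aS.
Qed.

Definition word_length (G : groupType) (S : seq G) (genS : generates S)
    (g : G) : nat :=
  ex_minn (spelled_in_ex genS g).

End Groups.
Arguments derived_subgroup : clear implicits.

(* Standard Borel: isomorphic, as a measurable space, to a separable completely
   metrizable space with its Borel sigma-algebra. *)
Definition standard_borel (R : realType) (d : measure_display)
    (T : measurableType d) : Prop :=
  exists (X : completePseudoMetricType R) (f : T -> X),
    [/\ hausdorff_space X,
        exists2 D : set X, countable D & dense D,
        bijective f &
        forall A : set T, measurable A <->
          exists2 B : set X, <<s [set U : set X | open U] >> B & A = f @^-1` B].

Record mp_action (G : groupType) (R : realType) (d : measure_display)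
    (T : measurableType d) (mu : probability T R) := MpAction {
  act :> G -> T -> T;
  act1 : forall w, act 1%g w = w;
  actM : forall g h w, act (g * h)%g w = act g (act h w);
  act_measurable : forall g, measurable_fun [set: T] (act g);
  act_preserving : forall g (A : set T), measurable A ->
    mu (act g @^-1` A) = mu A
}.

Section Lp.
Context (R : realType) (d : measure_display) (T : measurableType d).
Context (mu : probability T R) (p : R) (p1 : (1 <= p%:E)%E).

Local Notation borelR := (measurableTypeR R).
Local Notation Lp := (LspaceType mu p1).

Lemma Lnorm_ae_eq (f g : T -> R) :
  measurable_fun [set: T] f -> measurable_fun [set: T] g ->
  f = g %[ae mu] ->
  ('N[mu]_p%:E [EFin \o f] = 'N[mu]_p%:E [EFin \o g])%E.
Proof.
move=> mf mg fg; rewrite unlock; congr (_ `^ _)%E.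
have mN (h : T -> R) : measurable_fun [set: T] h ->
    measurable_fun [set: T] (fun x => (`|(EFin \o h) x| `^ p)%E : \bar R).
  move=> mh; apply: (measurableT_comp (measurable_poweR _)) => //.
  by apply: measurableT_comp => //; exact/measurable_EFinP.
apply: ae_eq_integral => //; [exact: mN|exact: mN|].
by apply: filterS fg => x /= /[apply] ->.
Qed.

(* The integrable functions of the library take values in [R] and its classes
   in [measurableTypeR R], which is [R] with the same measurable sets but
   another display. *)
Definition borel_fun (f : LfunType mu p1) : T -> borelR := f.

Lemma borel_fun_measurable (f : LfunType mu p1) :
  measurable_fun [set: T] (borel_fun f).
Proof. exact: (@measurable_funPT _ _ _ _ f). Qed.

HB.instance Definition _ (f : LfunType mu p1) :=
  isMeasurableFun.Build d _ T borelR (borel_fun f) (borel_fun_measurable f).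

Definition aeclass (f : LfunType mu p1) : {mfun_ mu, T >-> borelR} :=
  (\pi_({mfun_ mu, T >-> borelR}) (borel_fun f : {mfun T >-> borelR}))%qT.

Lemma aeclassE (f : LfunType mu p1) : (aeclass f : T -> R) = f %[ae mu].
Proof.
have /eqmodP/asboolP : (\pi_({mfun_ mu, T >-> borelR}) (repr (aeclass f)) =
  \pi_({mfun_ mu, T >-> borelR}) (borel_fun f : {mfun T >-> borelR}))%qT.
  by rewrite reprK.
by [].
Qed.

Lemma aeclass_finite (f : LfunType mu p1) : finite_norm mu p%:E (aeclass f).
Proof.
rewrite /finite_norm (@Lnorm_ae_eq _ f); last exact: aeclassE.
- exact: Lfunction_finite.
- exact: (@measurable_funPT _ _ _ _ (repr (aeclass f))).
- exact: (@measurable_funPT _ _ _ _ f).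
Qed.

HB.instance Definition _ (f : LfunType mu p1) :=
  isFinLebesgue.Build d T R mu p%:E p1 (aeclass f) (aeclass_finite f).

Definition Lp_class (f : LfunType mu p1) : Lp := aeclass f.

Definition representative (u : Lp) : T -> R := u.

Lemma representative_measurable (u : Lp) :
  measurable_fun [set: T] (representative u).
Proof.
exact: (@measurable_funPT _ _ _ _ (repr (u : {mfun_ mu, T >-> borelR}))).
Qed.

Lemma representative_finite (u : Lp) : finite_norm mu p%:E (representative u).
Proof. exact: Lebesgue_finite. Qed.

HB.instance Definition _ (u : Lp) :=
  isMeasurableFun.Build d _ T R (representative u) (representative_measurable u).
HB.instance Definition _ (u : Lp) :=
  isLfunction.Build d T R mu p%:E p1 (representative u) (representative_finite u).

Definition Lp_repr (u : Lp) : LfunType mu p1 := representative u.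

Definition Lp_add (u v : Lp) : Lp := Lp_class (Lp_repr u + Lp_repr v).

Definition Lp_norm (u : Lp) : R := fine ('N[mu]_p%:E [EFin \o Lp_repr u])%E.

Lemma Lp_classE (f : LfunType mu p1) : Lp_repr (Lp_class f) = f %[ae mu].
Proof. exact: aeclassE. Qed.

Lemma Lp_ext (u v : Lp) : Lp_repr u = Lp_repr v %[ae mu] -> u = v.
Proof.
case: u v => [u [[pu]]] [v [[pv]]] /= uv.
have {}uv : u = v.
  by rewrite -(reprK u) -(reprK v); apply/eqmodP/asboolP.
by rewrite uv in pu *; congr LebesgueSpace.Pack; rewrite (Prop_irrelevance pu pv).
Qed.

Section Koopman.
Context (G : groupType) (A : mp_action G mu).

Definition koopman (g : G) (f : T -> R) : T -> R := fun w => f (A g^-1%g w).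

Lemma koopman_measurable (g : G) (f : LfunType mu p1) :
  measurable_fun [set: T] (koopman g f).
Proof. by apply: measurableT_comp => //; exact: act_measurable. Qed.

Lemma koopman_Lnorm (g : G) (f : LfunType mu p1) :
  ('N[mu]_p%:E [EFin \o koopman g f] = 'N[mu]_p%:E [EFin \o f])%E.
Proof.
rewrite unlock; congr (_ `^ _)%E.
pose F : T -> \bar R := fun x => (`|(EFin \o f) x| `^ p)%E.
have mF : measurable_fun [set: T] F.
  apply: (measurableT_comp (measurable_poweR _)) => //.
  by apply: measurableT_comp => //; exact/measurable_EFinP.
transitivity (\int[pushforward mu (A g^-1%g)]_x F x)%E.
  rewrite ge0_integral_pushforward//; first exact: act_measurable.
  by move=> x _; exact: poweR_ge0.
apply: eq_measure_integral => [|mA B mB _]; first exact: act_measurable.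
exact: act_preserving.
Qed.

Lemma koopman_finite (g : G) (f : LfunType mu p1) :
  finite_norm mu p%:E (koopman g f).
Proof. by rewrite /finite_norm koopman_Lnorm; exact: Lfunction_finite. Qed.

HB.instance Definition _ (g : G) (f : LfunType mu p1) :=
  isMeasurableFun.Build d _ T R (koopman g f) (koopman_measurable g f).
HB.instance Definition _ (g : G) (f : LfunType mu p1) :=
  isLfunction.Build d T R mu p%:E p1 (koopman g f) (koopman_finite g f).

Definition Lp_koopman (g : G) (u : Lp) : Lp :=
  Lp_class (koopman g (Lp_repr u)).

Definition cocycle (b : G -> Lp) : Prop :=
  forall g h : G, b (g * h)%g = Lp_add (b g) (Lp_koopman g (b h)).

End Koopman.
End Lp.

(* The filter of [c : C] with [len c -> oo]. *)
Definition at_infinity (C : Type) (len : C -> nat) : set_system C :=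
  filter_from [set: nat] (fun N => [set c | (N <= len c)%N]).

(* Main.v *)
(* Let z generate C and let w_n be the average of b(z^k) over k <= n. As z is
   central, the ergodic averages M_n of pi(z) satisfy
   M_n b(g) = b(g) + pi(g) w_n - w_n, so that
   ||b(c)|| <= 2 ||w_n|| + ||M_n b(c)||, and M_n b is again a cocycle. By the
   mean ergodic theorem M_n b(s) is Cauchy for the finitely many generators s,
   hence ||M_n b(g) - M_m b(g)|| <= e |g| for all g once n, m are large. It
   remains to see that M_m b(c) -> 0 for each fixed c in C. For this, u_m, the
   truncation of M_m b(z) to [-1, 1], is asymptotically invariant under the
   whole group, so g |-> int b(g) u_m is asymptotically a homomorphism to R and
   tends to 0 on the derived subgroup; pairing M_m b(z) with its own truncation
   then forces M_m b(z) -> 0. *)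
Require Import Defs.
From HB Require Import structures.
From mathcomp Require Import all_boot all_order all_algebra.
From mathcomp Require Import all_classical all_reals all_analysis.
From mathcomp Require Import measurable_realfun ring lra.
Set Implicit Arguments.
Unset Strict Implicit.
Unset Printing Implicit Defensive.
Import Order.TTheory GRing.Theory Num.Theory.
Import numFieldNormedType.Exports.
Local Open Scope classical_set_scope.
Local Open Scope ring_scope.

(** * L^r seminorms of functions on a probability space *)

Section LpSeminorm.
Context (d : measure_display) (T : measurableType d) (R : realType).
Context (mu : probability T R).
Implicit Types (f g : T -> R) (r : R).

(** [fine] sends an infinite norm to 0, so the value is meaningful only on [Lfun], where [nrmE]
    recovers the extended norm. *)
Definition nrm r f : R := fine ('N[mu]_r%:E [EFin \o f])%E.

Lemma Lfun_measurable r f : f \in Lfun mu r%:E -> measurable_fun [set: T] f.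
Proof. by case/andP; rewrite inE. Qed.

Lemma Lfun_finite r f : f \in Lfun mu r%:E -> ('N[mu]_r%:E [EFin \o f] < +oo)%E.
Proof. by case/andP => _; rewrite inE. Qed.

Lemma LfunI r f : measurable_fun [set: T] f ->
  ('N[mu]_r%:E [EFin \o f] < +oo)%E -> f \in Lfun mu r%:E.
Proof. by move=> mf ff; apply/andP; split; rewrite inE. Qed.

Lemma nrmE r f : f \in Lfun mu r%:E -> ((nrm r f)%:E = 'N[mu]_r%:E [EFin \o f])%E.
Proof.
move=> /Lfun_finite ff; rewrite /nrm fineK// ge0_fin_numE//; exact: Lnorm_ge0.
Qed.

Lemma nrm_ge0 r f : 0 <= nrm r f.
Proof. by rewrite fine_ge0// Lnorm_ge0. Qed.

Lemma eq_ae_nrm r f g : f \in Lfun mu r%:E -> g \in Lfun mu r%:E ->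
  f = g %[ae mu] -> nrm r f = nrm r g.
Proof.
move=> /Lfun_measurable mf /Lfun_measurable mg fg.
by congr fine; exact: Lnorm_ae_eq.
Qed.

Section OneExponent.
Context (r : R) (r1 : 1 <= r).
Let r1e : (1 <= r%:E)%E. Proof. by rewrite lee_fin. Qed.
Let r0 : 0 < r. Proof. exact: lt_le_trans r1. Qed.

Lemma Lfun0 : (fun=> 0) \in Lfun mu r%:E.
Proof. exact: Lfun_cst. Qed.

Lemma LfunZ a f : f \in Lfun mu r%:E -> a \*: f \in Lfun mu r%:E.
Proof.
move=> Lf; have := (Lfun_submod_closed mu r1e).2 a f _ Lf Lfun0.
by rewrite (_ : a *: _ + _ = a \*: f)//; apply/funext => x; exact: addr0.
Qed.

Lemma LfunD f g : f \in Lfun mu r%:E -> g \in Lfun mu r%:E ->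
  f \+ g \in Lfun mu r%:E.
Proof.
move=> Lf Lg; have := (Lfun_submod_closed mu r1e).2 1 f g Lf Lg.
by rewrite scale1r.
Qed.

Lemma LfunB f g : f \in Lfun mu r%:E -> g \in Lfun mu r%:E ->
  f \- g \in Lfun mu r%:E.
Proof.
move=> Lf Lg; rewrite (_ : f \- g = f \+ (-1) \*: g); last first.
  by apply/funext => x /=; rewrite scaleN1r.
by apply: LfunD => //; exact: LfunZ.
Qed.

Lemma nrmZ a f : f \in Lfun mu r%:E -> nrm r (a \*: f) = `|a| * nrm r f.
Proof.
move=> Lf; apply: EFin_inj; rewrite EFinM (nrmE Lf) (nrmE (LfunZ a Lf)).
exact: (LnormZ (Lfun_Sub r1e Lf)).
Qed.

Lemma nrmD f g : f \in Lfun mu r%:E -> g \in Lfun mu r%:E ->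
  nrm r (f \+ g) <= nrm r f + nrm r g.
Proof.
move=> Lf Lg; rewrite -lee_fin EFinD (nrmE Lf) (nrmE Lg) (nrmE (LfunD Lf Lg)).
apply: eminkowski; [exact: Lfun_measurable Lf|exact: Lfun_measurable Lg|].
by rewrite lee_fin.
Qed.

Lemma nrmB f g : f \in Lfun mu r%:E -> g \in Lfun mu r%:E ->
  nrm r (f \- g) <= nrm r f + nrm r g.
Proof.
move=> Lf Lg; rewrite (_ : f \- g = f \+ (-1) \*: g); last first.
  by apply/funext => x /=; rewrite scaleN1r.
apply: le_trans (nrmD Lf (LfunZ (-1) Lg)) _.
by rewrite nrmZ// normrN1 mul1r.
Qed.

Lemma nrm_subC f g : f \in Lfun mu r%:E -> g \in Lfun mu r%:E ->
  nrm r (f \- g) = nrm r (g \- f).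
Proof.
move=> Lf Lg; rewrite (_ : f \- g = (-1) \*: (g \- f)).
  by rewrite nrmZ ?normrN1 ?mul1r//; exact: LfunB.
by apply/funext => x /=; rewrite scaleN1r opprB.
Qed.

Lemma nrm_triangle f g h : f \in Lfun mu r%:E -> g \in Lfun mu r%:E ->
  h \in Lfun mu r%:E -> nrm r (f \- h) <= nrm r (f \- g) + nrm r (g \- h).
Proof.
move=> Lf Lg Lh; rewrite (_ : f \- h = (f \- g) \+ (g \- h)).
  by apply: nrmD; exact: LfunB.
by apply/funext => x /=; rewrite addrA subrK.
Qed.

Lemma Lfun_sum (I : Type) (s : seq I) (F : I -> T -> R) :
  (forall i, F i \in Lfun mu r%:E) ->
  (fun x => \sum_(i <- s) F i x) \in Lfun mu r%:E.
Proof.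
move=> LF; elim: s => [|i s IH].
  by under eq_fun do rewrite big_nil; exact: Lfun0.
by under eq_fun do rewrite big_cons; exact: LfunD.
Qed.

Lemma nrm0 : nrm r (fun=> 0) = 0.
Proof.
transitivity (nrm r (0 \*: (fun=> 0 : R))); last first.
  by rewrite (nrmZ 0 Lfun0) normr0 mul0r.
by congr nrm; apply/funext => x /=; rewrite scale0r.
Qed.

Lemma nrm_sum (I : Type) (s : seq I) (F : I -> T -> R) :
  (forall i, F i \in Lfun mu r%:E) ->
  nrm r (fun x => \sum_(i <- s) F i x) <= \sum_(i <- s) nrm r (F i).
Proof.
move=> LF; elim: s => [|i s IH].
  by under eq_fun do rewrite big_nil; rewrite nrm0 big_nil.
under eq_fun do rewrite big_cons.
rewrite big_cons (le_trans (nrmD (LF i) (Lfun_sum s LF)))// lerD2l//.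
Qed.

Let measurable_abse_poweR f : measurable_fun [set: T] f ->
  measurable_fun [set: T] (fun x => `|(EFin \o f) x| `^ r)%E.
Proof.
move=> mf; apply: (measurableT_comp (measurable_poweR _)) => //.
by apply: measurableT_comp => //; exact/measurable_EFinP.
Qed.

Lemma nrm_powR f : f \in Lfun mu r%:E ->
  ((nrm r f `^ r)%:E = \int[mu]_x (`|f x| `^ r)%:E)%E.
Proof.
move=> Lf; rewrite -poweR_EFin (nrmE Lf) poweR_Lnorm ?gt_eqF//.
Qed.

Lemma ler_nrm f g : measurable_fun [set: T] f -> g \in Lfun mu r%:E ->
  (forall x, `|f x| <= `|g x|) -> f \in Lfun mu r%:E /\ nrm r f <= nrm r g.
Proof.
move=> mf Lg fg.
have mg := Lfun_measurable Lg.
have le_fg : ('N[mu]_r%:E [EFin \o f] <= 'N[mu]_r%:E [EFin \o g])%E.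
  rewrite unlock; apply: gt0_ler_poweR; rewrite ?invr_ge0 ?(ltW r0)//.
  - by rewrite in_itv/= leey integral_ge0// => x _; exact: poweR_ge0.
  - by rewrite in_itv/= leey integral_ge0// => x _; exact: poweR_ge0.
  apply: ge0_le_integral => //; [by move=> x _; exact: poweR_ge0
    |exact: measurable_abse_poweR|exact: measurable_abse_poweR|].
  by move=> x _ /=; rewrite lee_fin ge0_ler_powR ?nnegrE ?(ltW r0).
have Lf : f \in Lfun mu r%:E.
  by apply: LfunI => //; apply: le_lt_trans le_fg (Lfun_finite Lg).
by split=> //; rewrite -lee_fin !nrmE.
Qed.

Lemma bounded_Lfun f (K : R) : measurable_fun [set: T] f -> (forall x, `|f x| <= K) ->
  f \in Lfun mu r%:E.
Proof.
move=> mf fK; apply: (@ler_nrm f (fun=> K) mf _ _).1; first exact: Lfun_cst.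
by move=> x; rewrite (le_trans (fK x))// ler_norm.
Qed.

Lemma Lfun_comp (tau : T -> T) f : measurable_fun [set: T] tau ->
  (forall B, measurable B -> mu (tau @^-1` B) = mu B) ->
  f \in Lfun mu r%:E ->
  f \o tau \in Lfun mu r%:E /\ nrm r (f \o tau) = nrm r f.
Proof.
move=> mtau tau_pres Lf; have mf := Lfun_measurable Lf.
have eN : ('N[mu]_r%:E [EFin \o (f \o tau)] = 'N[mu]_r%:E [EFin \o f])%E.
  rewrite unlock; congr (_ `^ _)%E.
  transitivity (\int[pushforward mu tau]_x (`|(EFin \o f) x| `^ r))%E.
    rewrite ge0_integral_pushforward//; first exact: measurable_abse_poweR.
    by move=> x _; exact: poweR_ge0.
  by apply: eq_measure_integral => B mB _; exact: tau_pres.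
split; last by rewrite /nrm eN.
by apply: LfunI; [exact: measurableT_comp|rewrite eN; exact: Lfun_finite].
Qed.

Lemma Lfun_Lfun1 f : f \in Lfun mu r%:E -> f \in Lfun mu 1%:E.
Proof.
by apply: Lfun_subset => //; rewrite ?lexx//; exact: fin_num_measure.
Qed.

End OneExponent.

Lemma nrm1E f : f \in Lfun mu 1%:E -> nrm 1 f = \int[mu]_x `|f x|.
Proof. by move=> Lf; rewrite /nrm Lnorm1. Qed.

Lemma norm_Rintegral_le f : f \in Lfun mu 1%:E -> `|\int[mu]_x f x| <= nrm 1 f.
Proof.
by move=> Lf; rewrite nrm1E// le_normr_Rintegral//; exact/Lfun1_integrable.
Qed.

(** Hölder against the constant 1, which has norm 1 on a probability space. *)
Lemma nrm1_le_nrm2 f : f \in Lfun mu 2%:E -> nrm 1 f <= nrm 2 f.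
Proof.
move=> Lf; have Lf1 : f \in Lfun mu 1%:E.
  by apply: Lfun_Lfun1 Lf; rewrite ler1n.
rewrite -lee_fin !nrmE//.
have h : (2^-1 + 2^-1 = 1 :> R) by lra.
have m1 : measurable_fun [set: T] (@cst T R 1) by exact: measurable_cst.
have := @hoelder _ _ _ mu f (cst 1) 2 2 (Lfun_measurable Lf) m1 ltac:(by []) ltac:(by []) h.
rewrite (_ : f \* cst 1 = f); last by apply/funext => x /=; rewrite mulr1.
rewrite (_ : EFin \o cst 1 = cst 1%E)// Lnorm_cst1.
have e1 : (mu setT `^ 2^-1 = 1 :> \bar R)%E.
  by rewrite probability_setT poweR1r.
by rewrite [X in (_ * X)%E](_ : _ = 1%E) ?mule1.
Qed.

Lemma nrm_parallelogram f g : f \in Lfun mu 2%:E -> g \in Lfun mu 2%:E ->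
  nrm 2 (f \+ g) ^+ 2 + nrm 2 (f \- g) ^+ 2 = 2 * nrm 2 f ^+ 2 + 2 * nrm 2 g ^+ 2.
Proof.
move=> Lf Lg; have l12 : 1 <= 2 :> R by rewrite ler1n.
have sq h : h \in Lfun mu 2%:E -> nrm 2 h ^+ 2 = \int[mu]_x (h x ^+ 2).
  move=> Lh; rewrite -powR_mulrn ?nrm_ge0//; apply: EFin_inj.
  rewrite nrm_powR// /Rintegral fineK.
    by apply: eq_integral => x _; rewrite powR_mulrn// real_normK ?num_real.
  by apply: integrable_fin_num => //; exact: Lfun2_integrable_sqr.
have int h : h \in Lfun mu 2%:E -> mu.-integrable setT (EFin \o (fun x => h x ^+ 2)).
  exact: Lfun2_integrable_sqr.
have intZ h : h \in Lfun mu 2%:E ->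
    mu.-integrable setT (EFin \o (fun x => 2 * h x ^+ 2)).
  move=> Lh; rewrite (_ : _ \o _ = (fun x => 2%:E * (h x ^+ 2)%:E)%E)//.
  by apply: integrableZl => //; exact: int.
have LD := LfunD l12 Lf Lg; have LB := LfunB l12 Lf Lg.
have dbl h : h \in Lfun mu 2%:E ->
    2 * \int[mu]_x (h x ^+ 2) = \int[mu]_x (2 * h x ^+ 2).
  by move=> Lh; rewrite RintegralZl//; exact: int.
rewrite (sq _ LD) (sq _ LB) (sq _ Lf) (sq _ Lg) (dbl _ Lf) (dbl _ Lg).
rewrite -(RintegralD measurableT (int _ LD) (int _ LB)).
rewrite -(RintegralD measurableT (intZ _ Lf) (intZ _ Lg)).
by apply: eq_Rintegral => x _ /=; ring.
Qed.

(** Integrates the pointwise bound of [|f| ^ r] by [K ^ (r - 1)] times [|f|]. *)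
Lemma nrm_powR_bounded r f (K : R) : 1 <= r -> measurable_fun [set: T] f ->
  (forall x, `|f x| <= K) -> nrm r f `^ r <= K `^ (r - 1) * nrm 1 f.
Proof.
move=> r1 mf fK.
have Lr := bounded_Lfun r1 mf fK; have L1 := bounded_Lfun (lexx 1) mf fK.
rewrite -lee_fin (nrm_powR r1 Lr) EFinM (nrmE L1) Lnorm1.
rewrite -ge0_integralZl//; last 2 first.
- by apply: measurableT_comp => //; exact/measurable_EFinP.
- by rewrite lee_fin powR_ge0.
apply: ge0_le_integral => //.
- apply/measurable_EFinP/(@measurableT_comp _ _ _ _ _ _ (@powR R ^~ r)) => //.
  exact: measurableT_comp.
- apply: measurable_funeM; apply: measurableT_comp => //.
  exact/measurable_EFinP.
move=> x _; rewrite -EFinM lee_fin /=.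
(* Zero is set apart: the exponent law splitting [r] as [r - 1 + 1] is applied to a nonzero base. *)
have [->|fx0] := eqVneq (f x) 0.
  by rewrite normr0 mulr0 powR0// gt_eqF// (lt_le_trans _ r1).
rewrite -[in leLHS](subrK 1 r) (@powRD _ _ (r - 1) 1); last by rewrite normr_eq0 fx0 implybT.
rewrite powRr1// ler_wpM2r// ge0_ler_powR ?subr_ge0 ?nnegrE//.
exact: le_trans (fK x).
Qed.

(** * Truncation and density of bounded functions *)

Definition clamp (K t : R) : R := Num.max (- K) (Num.min K t).

(** On each of the three pieces [clamp] is affine, so inequalities about it reduce to linear
    arithmetic. *)
Lemma clampP (K t : R) : 0 <= K ->
  [\/ t <= - K /\ clamp K t = - K, K <= t /\ clamp K t = K |
      (- K <= t <= K) /\ clamp K t = t].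
Proof.
move=> K0; rewrite /clamp.
have [Kt|tK] := leP K t.
  by constructor 2; split=> //; apply: max_r; lra.
have [Kt|Kt] := leP (- K) t.
  by constructor 3; split=> //; lra.
by constructor 1; split=> //; lra.
Qed.

Lemma norm_clamp_le (K t : R) : 0 <= K -> `|clamp K t| <= K.
Proof. by move=> K0; rewrite ler_norml; case: (clampP t K0) => -[? ->]; lra. Qed.

Lemma clamp_lip (K s t : R) : 0 <= K -> `|clamp K s - clamp K t| <= `|s - t|.
Proof.
move=> K0; case: (clampP s K0) => -[? ->]; case: (clampP t K0) => -[? ->];
  case: (ger0P (s - t)) => ?; rewrite ?ler_norml; lra.
Qed.

(* [clamp K] is the metric projection onto [[-K, K]]. *)
Lemma clamp_proj (K t y : R) : `|y| <= K -> `|t - clamp K t| <= `|t - y|.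
Proof.
move=> yK; have K0 : 0 <= K by exact: le_trans yK.
move: yK; rewrite ler_norml => /andP[? ?]; case: (clampP t K0) => -[? ->];
  case: (ger0P (t - y)) => ?; rewrite ?ler_norml; lra.
Qed.

Lemma measurable_clamp K f : measurable_fun [set: T] f ->
  measurable_fun [set: T] (fun x => clamp K (f x)).
Proof. by move=> mf; apply: measurable_maxr => //; exact: measurable_minr. Qed.

(** The errors [f - clamp n f] tend to 0 pointwise and are dominated by [|f|]; dominated convergence
    applies to their [r]-th powers. *)
Lemma clamp_dense r f (e : R) : 1 <= r -> f \in Lfun mu r%:E -> 0 < e ->
  exists2 K : R, 0 <= K & nrm r (fun x => f x - clamp K (f x)) <= e.
Proof.
move=> r1 Lf e0; have mf := Lfun_measurable Lf.
have r0 : 0 < r by exact: lt_le_trans r1.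
pose h (n : nat) x := f x - clamp n%:R (f x).
have mh n : measurable_fun [set: T] (h n).
  by apply: measurable_funB => //; exact: measurable_clamp.
have hf n x : `|h n x| <= `|f x|.
  by rewrite -[in leRHS](subr0 (f x)); apply: clamp_proj; rewrite normr0.
have Lh n : h n \in Lfun mu r%:E by have [] := ler_nrm r1 (mh n) Lf (hf n).
have mp (g : T -> R) : measurable_fun [set: T] g ->
    measurable_fun [set: T] (fun x => (`|g x| `^ r)%:E).
  move=> mg; apply/measurable_EFinP.
  apply: (@measurableT_comp _ _ _ _ _ _ (@powR R ^~ r)) => //.
  exact: measurableT_comp.
(* At each point the sequence is eventually 0: [clamp n] fixes [f x] once [n >= |f x|]. *)
have cvg0 : {ae mu, forall x, setT x ->
    (fun n => (`|h n x| `^ r)%:E) @ \oo --> (cst 0%E : T -> \bar R) x}.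
  apply: aeW => x _; apply: cvg_near_cst.
  near=> n.
  suff e' : clamp n%:R (f x) = f x.
    by rewrite /h e' subrr normr0 powR0// gt_eqF.
  have : `|f x| <= n%:R by near: n; exact: nbhs_infty_ger.
  by rewrite ler_norml; case: (clampP (f x) (ler0n R n)) => -[? ->]; lra.
have dom : {ae mu, forall x n, setT x ->
    (`|(`|h n x| `^ r)%:E| <= (`|f x| `^ r)%:E)%E}.
  apply: aeW => x n _; rewrite gee0_abs ?lee_fin ?powR_ge0//.
  by rewrite ge0_ler_powR ?nnegrE ?(ltW r0).
have [_ _] := dominated_convergence measurableT (fun n => mp _ (mh n))
  (measurable_cst _) cvg0 (Lfun_integrable r1 Lf) dom.
rewrite integral0 => /fine_cvgP[_ /cvgrPdist_le /(_ _ (powR_gt0 r e0))] [n _ /(_ n (leqnn n))].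
rewrite /= sub0r normrN -(nrm_powR r1 (Lh n)) /= ger0_norm ?powR_ge0// => le_e.
exists n%:R => //; rewrite leNgt; apply/negP => lt_e.
by move: le_e; rewrite leNgt gt0_ltr_powR// nnegrE ?nrm_ge0 ?(ltW e0).
Unshelve. all: by end_near.
Qed.

End LpSeminorm.

(** * The mean ergodic theorem *)

(** [harmonic k] is [1 / (k + 1)]; errors of this order disappear in the limit. *)
Lemma ler_of_harmonic (R : realType) (x y C : R) :
  (forall k, x <= y + C * harmonic k) -> x <= y.
Proof.
move=> h; apply: (@ler_cvg_to nat \oo _ R (fun=> x) (fun k => y + C * harmonic k)).
- exact: cvg_cst.
- rewrite -[X in _ --> X](addr0 y) -[X in y + X](mulr0 C).
  apply: cvgD; first exact: cvg_cst.
  by apply: cvgM; [exact: cvg_cst|exact: cvg_harmonic].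
- exact: nearW h.
Qed.

Section ErgodicAverages.
Context (d : measure_display) (T : measurableType d) (R : realType).
Context (mu : probability T R) (tau : T -> T).
Context (mtau : measurable_fun [set: T] tau).
Context (tau_pres : forall B, measurable B -> mu (tau @^-1` B) = mu B).
Implicit Types (f g : T -> R) (r : R).
Local Notation nrm := (nrm mu).

(** The mean runs over the [n + 1] exponents from 0 to [n], so the divisor is never 0. *)
Definition avg (n : nat) f : T -> R :=
  fun x => n.+1%:R^-1 * \sum_(k < n.+1) f (iter k tau x).

Lemma iter_measurable k : measurable_fun [set: T] (iter k tau).
Proof.
elim: k => [|k IH]; first exact: measurable_id.
exact: measurableT_comp.
Qed.

Lemma iter_preserving k B : measurable B -> mu (iter k tau @^-1` B) = mu B.
Proof.
elim: k B => [|k IH] B mB //.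
rewrite (_ : _ @^-1` _ = iter k tau @^-1` (tau @^-1` B))//.
by rewrite IH ?tau_pres// -[_ @^-1` _]setTI; exact: mtau.
Qed.

Lemma avgD n f g : avg n (f \+ g) = avg n f \+ avg n g.
Proof. by apply/funext => x; rewrite /avg /= big_split /= mulrDr. Qed.

Lemma avgB n f g : avg n (f \- g) = avg n f \- avg n g.
Proof. by apply/funext => x; rewrite /avg /= sumrB mulrBr. Qed.

Lemma avg_bounded n f (K : R) : (forall x, `|f x| <= K) -> forall x, `|avg n f x| <= K.
Proof.
move=> fK x; rewrite /avg normrM ger0_norm ?invr_ge0 ?ler0n//.
rewrite ler_pdivrMl ?ltr0Sn// (le_trans (ler_norm_sum _ _ _))//.
apply: le_trans (ler_sum _ (fun (k : 'I_n.+1) _ => fK (iter k tau x))) _.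
by rewrite sumr_const card_ord mulr_natl.
Qed.

(** The two sums telescope and leave only their end terms. *)
Lemma avg_tau n f x :
  avg n (f \o tau) x - avg n f x = harmonic n * (f (iter n.+1 tau x) - f x).
Proof.
rewrite /avg -mulrBr; congr (_ * _).
by rewrite -(telescope_sumr (fun k => f (iter k tau x)) (leq0n n.+1)) big_mkord sumrB.
Qed.

Section OneExponent.
Context (r : R) (r1 : 1 <= r).
Local Notation inLr f := (f \in Lfun mu r%:E).

Lemma Lfun_iter k f : inLr f -> inLr (f \o iter k tau) /\ nrm r (f \o iter k tau) = nrm r f.
Proof.
by apply: Lfun_comp => //; [exact: iter_measurable|exact: iter_preserving].
Qed.

Lemma Lfun_avg n f : inLr f -> inLr (avg n f).
Proof.
move=> Lf; apply: (LfunZ r1 n.+1%:R^-1).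
by apply: (@Lfun_sum _ _ _ mu r r1 _ _ (fun k : 'I_n.+1 => f \o iter k tau)) => k;
  have [] := Lfun_iter k Lf.
Qed.

Lemma nrm_avg_le n f : inLr f -> nrm r (avg n f) <= nrm r f.
Proof.
move=> Lf; have LF (k : 'I_n.+1) : inLr (f \o iter k tau) by have [] := Lfun_iter k Lf.
rewrite (nrmZ r1 n.+1%:R^-1 (Lfun_sum r1 (index_enum _) LF)).
rewrite ger0_norm ?invr_ge0 ?ler0n// ler_pdivrMl ?ltr0Sn//.
apply: le_trans (nrm_sum r1 (index_enum _) LF) _.
rewrite (eq_bigr (fun=> nrm r f)); last by move=> k _; have [] := Lfun_iter k Lf.
by rewrite sumr_const card_ord mulr_natl.
Qed.

Lemma nrm_avg_tau n f : inLr f ->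
  nrm r (avg n (f \o tau) \- avg n f) <= 2 * nrm r f * harmonic n.
Proof.
move=> Lf; have [Lfn efn] := Lfun_iter n.+1 Lf.
rewrite (_ : _ \- _ = harmonic n \*: (f \o iter n.+1 tau \- f)); last first.
  by apply/funext => x; exact: avg_tau.
rewrite nrmZ//; last exact: LfunB.
rewrite ger0_norm ?invr_ge0 ?ler0n// mulrC ler_wpM2r ?invr_ge0 ?ler0n//.
by rewrite (le_trans (nrmB r1 Lfn Lf))// efn; lra.
Qed.

Lemma nrm_avg_iter n m f : inLr f ->
  nrm r (avg n (f \o iter m tau) \- avg n f) <= 2 * m%:R * nrm r f * harmonic n.
Proof.
move=> Lf; elim: m => [|m IH].
  rewrite (_ : _ \- _ = fun=> 0) ?nrm0 ?mulr0 ?mul0r//.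
  by apply/funext => x /=; rewrite subrr.
have [Lm em] := Lfun_iter m Lf; have [LSm _] := Lfun_iter m.+1 Lf.
have -> : f \o iter m.+1 tau = (f \o iter m tau) \o tau.
  by apply/funext => x; rewrite /= -iterSr.
have [Lmt _] := Lfun_comp mtau tau_pres Lm.
rewrite (le_trans (nrm_triangle r1 (Lfun_avg n Lmt) (Lfun_avg n Lm) (Lfun_avg n Lf)))//.
have := nrm_avg_tau n Lm; rewrite em -natr1 => h.
rewrite (le_trans (lerD h IH))//; lra.
Qed.

(** [avg n (avg m f)] is the mean over [k <= m] of [avg n (f \o iter k tau)], each of which is close
    to [avg n f]. For fixed [m] the bound vanishes as [n] grows. *)
Lemma nrm_avg_avg n m f : inLr f ->
  nrm r (avg n (avg m f) \- avg n f) <= 2 * m%:R * nrm r f * harmonic n.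
Proof.
move=> Lf.
pose F (k : 'I_m.+1) := avg n (f \o iter k tau) \- avg n f.
have LF k : inLr (F k).
  by apply: LfunB => //; apply: Lfun_avg => //; have [] := Lfun_iter k Lf.
rewrite (_ : _ \- _ = m.+1%:R^-1 \*: (fun x => \sum_k F k x)); last first.
  apply/funext => x; rewrite /F /=.
  rewrite sumrB sumr_const card_ord /GRing.scale /= mulrBr.
  rewrite -[X in _ = _ - _ * X]mulr_natl mulKf ?pnatr_eq0//; congr (_ - _).
  rewrite /avg -[in LHS]mulr_sumr -[in RHS]mulr_sumr mulrCA.
  by congr (_ * (_ * _)); rewrite exchange_big.
rewrite (nrmZ r1 m.+1%:R^-1 (Lfun_sum r1 (index_enum _) LF)).
rewrite ger0_norm ?invr_ge0 ?ler0n// ler_pdivrMl ?ltr0Sn//.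
apply: le_trans (nrm_sum r1 (index_enum _) LF) _.
have h (k : 'I_m.+1) : nrm r (F k) <= 2 * m%:R * nrm r f * harmonic n.
  rewrite (le_trans (nrm_avg_iter n k Lf))// ler_wpM2r ?invr_ge0 ?ler0n//.
  by rewrite ler_wpM2r ?nrm_ge0// ler_wpM2l// ler_nat -ltnS.
apply: le_trans (ler_sum _ (fun k _ => h k)) _.
by rewrite sumr_const card_ord [leRHS]mulr_natl.
Qed.

End OneExponent.

(* Parallelogram law: averages of norm close to the infimum [D] are close to
   each other, since their midpoint has norm at least [D]. *)
Lemma avg_cauchy2 f (e : R) : f \in Lfun mu 2%:E -> 0 < e ->
  exists n0, forall n m, (n0 <= n)%N -> (n0 <= m)%N ->
    nrm 2 (avg n f \- avg m f) <= e.
Proof.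
move=> Lf e0; have l12 : 1 <= 2 :> R by rewrite ler1n.
have La n := Lfun_avg l12 n Lf.
pose a n := nrm 2 (avg n f); pose D := inf (range a).
have lba : has_lbound (range a) by exists 0 => _ [n _ <-]; exact: nrm_ge0.
have Da n : D <= a n by apply: ge_inf => //; exists n.
have D0 : 0 <= D.
  by apply: lb_le_inf; [exists (a 0%N), 0%N|move=> _ [n _ <-]; exact: nrm_ge0].
(* Averaging [avg n f] once more does not increase its norm and gives [avg k f] up to an error of
   order [1 / k]. *)
have aa n k : a k <= a n + 2 * n%:R * nrm 2 f * harmonic k.
  have Lnk := Lfun_avg l12 k (La n).
  rewrite -lerBlDl (le_trans _ (nrm_avg_avg l12 k n Lf))//.
  have := nrmB l12 Lnk (LfunB l12 Lnk (La k)).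
  rewrite (_ : _ \- (_ \- _) = avg k f); last first.
    by apply/funext => x /=; rewrite opprB addrC subrK.
  have := nrm_avg_le l12 k (La n); rewrite /a; lra.
(* The [k]-th average of the sum is close to [2 \*: avg k f], of norm at least [2 * D], and
   averaging does not increase the norm. *)
have midD n m : 2 * D <= nrm 2 (avg n f \+ avg m f).
  apply: (@ler_of_harmonic _ _ _ (2 * n%:R * nrm 2 f + 2 * m%:R * nrm 2 f)) => k.
  have Ls := LfunD l12 (La n) (La m).
  have Lnk := Lfun_avg l12 k (La n); have Lmk := Lfun_avg l12 k (La m).
  have hn := nrm_avg_avg l12 k n Lf; have hm := nrm_avg_avg l12 k m Lf.
  have hs := nrm_avg_le l12 k Ls.
  have LB := LfunD l12 (LfunB l12 Lnk (La k)) (LfunB l12 Lmk (La k)).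
  have h1 := nrmD l12 (LfunB l12 Lnk (La k)) (LfunB l12 Lmk (La k)).
  have := nrmB l12 (Lfun_avg l12 k Ls) LB.
  rewrite (_ : _ \- _ = 2 \*: avg k f); last first.
    by apply/funext => x; rewrite avgD /= /GRing.scale /=; ring.
  rewrite nrmZ// ger0_norm// => h2; have := Da k; rewrite /a; lra.
(* For two averages of norm at most [D + 2 * del], the parallelogram law bounds the squared distance
   by [4 * (D + 2 * del) ^+ 2 - 4 * D ^+ 2], that is [16 * del * (D + del)]; [del <= 1] makes the
   choice of [del] explicit. *)
have [del [del0 del1 del2]] :
    exists del : R, [/\ 0 < del, del <= 1 & 16 * del * (D + 1) <= e ^+ 2].
  have D1 : 0 < 16 * (D + 1) by lra.
  exists (Num.min 1 (e ^+ 2 / (16 * (D + 1)))); split.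
  - by rewrite lt_min ltr01 divr_gt0 ?exprn_gt0.
  - by rewrite ge_min lexx.
  rewrite mulrAC -ler_pdivlMl// mulrC.
  by rewrite ge_min lexx orbT.
have [_ [n1 _ <-] an1] : exists2 x, range a x & x < D + del.
  by apply: inf_adherent => //; split=> //; exists (a 0%N), 0%N.
(* By [aa n1], the single almost minimal average [n1] controls all sufficiently late ones. *)
have [n0 n0P] : exists n0, forall k, (n0 <= k)%N -> a k <= D + 2 * del.
  have C0 : 0 <= 2 * n1%:R * nrm 2 f by rewrite !mulr_ge0 ?nrm_ge0.
  have : 2 * n1%:R * nrm 2 f * harmonic k @[k --> \oo] --> (0 : R).
    rewrite -[X in _ --> X](mulr0 (2 * n1%:R * nrm 2 f)).
    by apply: cvgM; [exact: cvg_cst|exact: cvg_harmonic].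
  move=> /cvgrPdist_le /(_ _ del0) [n0 _ h]; exists n0 => k /h /=.
  rewrite sub0r normrN ler_norml => /andP[_ hk]; have := aa n1 k.
  move=> /le_trans; apply; have -> : D + 2 * del = D + del + del by ring.
  by apply: lerD hk; exact: ltW.
exists n0 => n m /n0P an /n0P am.
rewrite -(@ler_pXn2r _ 2) ?nnegrE ?nrm_ge0 ?(ltW e0)//.
have := nrm_parallelogram (La n) (La m).
have mid2 : (2 * D) ^+ 2 <= nrm 2 (avg n f \+ avg m f) ^+ 2.
  by rewrite ler_pXn2r ?nnegrE ?nrm_ge0 ?mulr_ge0.
have sq k : a k <= D + 2 * del -> nrm 2 (avg k f) ^+ 2 <= (D + 2 * del) ^+ 2.
  by move=> h; rewrite ler_pXn2r ?nnegrE ?nrm_ge0// addr_ge0// mulr_ge0// ltW.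
have := sq _ an; have := sq _ am.
have : 16 * del * (D + del) <= e ^+ 2.
  apply: le_trans del2; apply: ler_wpM2l; first by rewrite mulr_ge0// ltW.
  by rewrite lerD2l.
lra.
Qed.

(** Uniform form of [nrm_powR_bounded]: among functions bounded by [K], smallness in L^1 forces
    smallness in L^r. *)
Lemma nrm_small_bounded r (K e : R) : 1 <= r -> 0 < e ->
  exists2 del : R, 0 < del & forall h : T -> R, measurable_fun [set: T] h ->
    (forall x, `|h x| <= K) -> nrm 1 h <= del -> nrm r h <= e.
Proof.
move=> r1 e0; have r0 : 0 < r by exact: lt_le_trans r1.
(* The added 1 keeps the divisor positive when the power of [K] is 0. *)
have C0 : 0 < K `^ (r - 1) + 1 by rewrite ltr_wpDl// powR_ge0.
exists (e `^ r / (K `^ (r - 1) + 1)); first by rewrite divr_gt0// powR_gt0.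
move=> h mh hK; rewrite ler_pdivlMr// => hdel.
rewrite leNgt; apply/negP => lt_e.
have : e `^ r < nrm r h `^ r by rewrite gt0_ltr_powR// nnegrE ?nrm_ge0 ?(ltW e0).
rewrite ltNge => /negP; apply.
rewrite (le_trans (nrm_powR_bounded mu r1 mh hK))// (le_trans _ hdel)//.
by rewrite mulrC ler_wpM2l ?nrm_ge0// lerDl.
Qed.

(** Averaging is a contraction, so [f] may be replaced by a truncation [g]. The averages of [g] are
    Cauchy in L^2, hence in L^1, and being uniformly bounded they are Cauchy in L^r. *)
Lemma avg_cauchy r f (e : R) : 1 <= r -> f \in Lfun mu r%:E -> 0 < e ->
  exists n0, forall n m, (n0 <= n)%N -> (n0 <= m)%N ->
    nrm r (avg n f \- avg m f) <= e.
Proof.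
move=> r1 Lf e0; have e4 : 0 < e / 4 by rewrite divr_gt0.
have l12 : 1 <= 2 :> R by rewrite ler1n.
have [K K0 fK] := clamp_dense r1 Lf e4.
pose g x := clamp K (f x).
have mg : measurable_fun [set: T] g by exact/measurable_clamp/Lfun_measurable/Lf.
have gK x : `|g x| <= K by exact: norm_clamp_le.
have Lg := bounded_Lfun mu r1 mg gK.
have [del del0 delP] := nrm_small_bounded (K + K) r1 e4.
have [n0 n0P] := avg_cauchy2 (bounded_Lfun mu l12 mg gK) del0.
exists n0 => n m n0n n0m.
have Lag k := Lfun_avg r1 k Lg; have Laf k := Lfun_avg r1 k Lf.
have L2 k := Lfun_avg l12 k (bounded_Lfun mu l12 mg gK).
have small : nrm r (avg n g \- avg m g) <= e / 4.
  apply: delP.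
  - exact: Lfun_measurable (LfunB r1 (Lag n) (Lag m)).
  - move=> x; rewrite (le_trans (ler_normB _ _))//.
    by rewrite lerD//; exact: avg_bounded.
  - apply: le_trans (n0P n m n0n n0m).
    by apply: nrm1_le_nrm2; exact: LfunB.
have fg k : nrm r (avg k f \- avg k g) <= e / 4.
  by rewrite -avgB (le_trans (nrm_avg_le r1 k (LfunB r1 Lf Lg))).
have := nrm_triangle r1 (Laf n) (Lag n) (Laf m).
have := nrm_triangle r1 (Lag n) (Lag m) (Laf m).
have := fg n; have := fg m; rewrite nrm_subC//; lra.
Qed.

(** Splits [avg n f] into its truncation, which is bounded and small in L^1, and a remainder that is
    small in L^r for every [n]. *)
Lemma avg_cvg0_nrm1 r f : 1 <= r -> f \in Lfun mu r%:E ->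
  nrm 1 (avg n f) @[n --> \oo] --> (0 : R) -> nrm r (avg n f) @[n --> \oo] --> (0 : R).
Proof.
move=> r1 Lf cvg1; apply/cvgrPdist_le => e e0; have e2 : 0 < e / 2 by rewrite divr_gt0.
have [K K0 fK] := clamp_dense r1 Lf e2.
have [del del0 delP] := nrm_small_bounded K r1 e2.
pose g x := clamp K (f x).
have mg : measurable_fun [set: T] g by exact/measurable_clamp/Lfun_measurable/Lf.
have gK x : `|g x| <= K by exact: norm_clamp_le.
have Lg := bounded_Lfun mu r1 mg gK.
move/cvgrPdist_le : cvg1 => /(_ _ del0); apply: filterS => n.
rewrite !sub0r !normrN !ger0_norm ?nrm_ge0// => nrm1_del.
pose h x := clamp K (avg n f x).
have Laf := Lfun_avg r1 n Lf.
have mh : measurable_fun [set: T] h by exact/measurable_clamp/Lfun_measurable/Laf.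
have hK x : `|h x| <= K by exact: norm_clamp_le.
have Lh := bounded_Lfun mu r1 mh hK.
have hsmall : nrm r h <= e / 2.
  apply: delP => //; apply: le_trans nrm1_del.
  apply: (ler_nrm (lexx 1) mh (Lfun_Lfun1 r1 Laf) _).2 => x.
  have := clamp_lip (avg n f x) 0 K0.
  by rewrite (_ : clamp K 0 = 0) ?subr0//; case: (clampP 0 K0) => -[? ->]; lra.
(* [avg n g] has values in [[-K, K]] and [clamp K] is the nearest point there, so the remainder is
   dominated by [avg n f - avg n g], the average of [f - g]. *)
have hdist : nrm r (avg n f \- h) <= e / 2.
  apply: le_trans fK; apply: le_trans (nrm_avg_le r1 n (LfunB r1 Lf Lg)).
  rewrite avgB.
  apply: (ler_nrm r1 _ (LfunB r1 Laf (Lfun_avg r1 n Lg)) _).2.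
    exact: Lfun_measurable (LfunB r1 Laf Lh).
  by move=> x /=; apply: clamp_proj; exact: avg_bounded.
have := nrmD r1 (LfunB r1 Laf Lh) Lh.
rewrite (_ : _ \+ _ = avg n f); last by apply/funext => x /=; rewrite subrK.
lra.
Qed.

End ErgodicAverages.

(** * Asymptotic homomorphisms and pairings with bounded functions *)

(** Follows a shortest word for [g], each letter costing at most [e]; [lenV] covers the inverses of
    generators. *)
Lemma subadditive_word_length (G : groupType) (S : seq G) (genS : generates S)
    (R : realType) (len : G -> R) (e : R) : len 1%g <= 0 ->
  (forall g h, len (g * h)%g <= len g + len h) ->
  (forall g, len g^-1%g = len g) ->
  (forall s, s \in S -> len s <= e) ->
  forall g, len g <= e * (word_length genS g)%:R.
Proof.
move=> len1 lenM lenV lenS g; rewrite /word_length.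
case: ex_minnP => n /asboolP[w [wS <- ->]] _.
elim: w wS => [|x w IH] /=; first by rewrite big_nil mulr0.
case/andP => xS wS; rewrite big_cons (le_trans (lenM _ _))//.
rewrite -natr1 mulrDr mulr1 addrC lerD ?IH//.
by case/orP : xS => [/lenS//|/lenS]; rewrite lenV.
Qed.

(** The elements along which [phi] tends to 0 form a subgroup. It contains commutators: in [x * y =
    (y * x) * [~ x, y]] the values at [x] and [y] cancel up to defects that vanish in the limit. The
    sequences [phi n x] themselves need not converge. *)
Lemma derived_subgroup_asymptotic_hom (G : groupType) (R : realType)
    (phi : nat -> G -> R) :
  (forall g h, phi n (g * h)%g - (phi n g + phi n h) @[n --> \oo] --> (0 : R)) ->
  forall g, derived_subgroup G g -> phi n g @[n --> \oo] --> (0 : R).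
Proof.
move=> hom; pose to0 (g : G) := phi n g @[n --> \oo] --> (0 : R).
have eq0 (u v : nat -> R) : u n - v n @[n --> \oo] --> (0 : R) ->
    v @ \oo --> (0 : R) -> u @ \oo --> (0 : R).
  move=> uv v0; rewrite -[X in _ --> X](addr0 0).
  rewrite (_ : u = (fun n => (u n - v n) + v n)); first exact: cvgD.
  by apply/funext => n; rewrite subrK.
have to01 : to0 1%g.
  have := hom 1%g 1%g; rewrite mulg1 => h.
  rewrite /to0 -[X in _ --> X]oppr0.
  rewrite (_ : (fun n => phi n 1%g) = (fun n => - (phi n 1%g - (phi n 1%g + phi n 1%g)))).
    exact: cvgN.
  by apply/funext => n; ring.
have to0M g h : to0 g -> to0 h -> to0 (g * h)%g.
  move=> g0 h0; apply: eq0 (hom g h) _.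
  by rewrite -[X in _ --> X](addr0 0); exact: cvgD.
have to0l g h : to0 (g * h)%g -> to0 g -> to0 h.
  move=> gh0 g0.
  rewrite /to0 (_ : (fun n => phi n h) =
    (fun n => (phi n (g * h)%g - phi n g) - (phi n (g * h)%g - (phi n g + phi n h)))).
    rewrite -[X in _ --> X](subr0 0); apply: cvgB => //.
    by rewrite -[X in _ --> X](subr0 0); exact: cvgB.
  by apply/funext => n; ring.
have to0V g : to0 g -> to0 g^-1%g.
  by move=> g0; apply: to0l g0; rewrite mulgV.
have to0_comm x y : to0 [~ x, y]%g.
  have e : (x * y = (y * x) * [~ x, y])%g by rewrite commgC.
  have h1 := hom (y * x)%g [~ x, y]%g; rewrite -e in h1.
  rewrite /to0 (_ : (fun n => phi n [~ x, y]%g) = (fun n =>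
     (phi n (x * y)%g - (phi n x + phi n y)) - (phi n (y * x)%g - (phi n y + phi n x))
     - (phi n (x * y)%g - (phi n (y * x)%g + phi n [~ x, y]%g)))); last first.
    by apply/funext => n; ring.
  rewrite -[X in _ --> X](subr0 0); apply: cvgB => //.
  by rewrite -[X in _ --> X](subr0 0); apply: cvgB.
move=> g gE; have /asboolP : g \in [pred x | `[< to0 x >]] => //.
apply: gE => [|_ [x [y ->]]]; last exact/asboolP.
split; first exact/asboolP.
by move=> x y /asboolP x0 /asboolP y0; apply/asboolP/to0M => //; exact: to0V.
Qed.

Section L1Pairing.
Context (d : measure_display) (T : measurableType d) (R : realType).
Context (mu : probability T R).
Implicit Types (f g u : T -> R).
Local Notation nrm := (nrm mu).

Lemma nrm1_mul_bounded f u (K : R) : 0 <= K -> f \in Lfun mu 1%:E ->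
  measurable_fun [set: T] u -> (forall x, `|u x| <= K) ->
  f \* u \in Lfun mu 1%:E /\ nrm 1 (f \* u) <= K * nrm 1 f.
Proof.
move=> K0 Lf m_u uK; have LKf := LfunZ (lexx 1) K Lf.
have := ler_nrm (lexx 1) (measurable_funM (Lfun_measurable Lf) m_u) LKf.
rewrite (nrmZ (lexx 1) K Lf) (ger0_norm K0); apply => x /=.
by rewrite /GRing.scale /= !normrM mulrC (ger0_norm K0) ler_wpM2r.
Qed.

Lemma ae_eq_Rintegral f g : f \in Lfun mu 1%:E -> g \in Lfun mu 1%:E ->
  f = g %[ae mu] -> \int[mu]_x f x = \int[mu]_x g x.
Proof.
move=> Lf Lg fg; congr fine; apply: ae_eq_integral => //.
- by apply/measurable_EFinP; exact: Lfun_measurable Lf.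
- by apply/measurable_EFinP; exact: Lfun_measurable Lg.
by apply: filterS fg => x /= /[apply] ->.
Qed.

Lemma RintegralD1 f g : f \in Lfun mu 1%:E -> g \in Lfun mu 1%:E ->
  \int[mu]_x (f x + g x) = \int[mu]_x f x + \int[mu]_x g x.
Proof. by move=> Lf Lg; rewrite RintegralD//; exact/Lfun1_integrable. Qed.

Lemma RintegralB1 f g : f \in Lfun mu 1%:E -> g \in Lfun mu 1%:E ->
  \int[mu]_x (f x - g x) = \int[mu]_x f x - \int[mu]_x g x.
Proof. by move=> Lf Lg; rewrite RintegralB//; exact/Lfun1_integrable. Qed.

Lemma Rintegral_comp (tau : T -> T) f : measurable_fun [set: T] tau ->
  (forall B, measurable B -> mu (tau @^-1` B) = mu B) ->
  f \in Lfun mu 1%:E -> \int[mu]_x f (tau x) = \int[mu]_x f x.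
Proof.
move=> mtau tau_pres Lf; congr fine.
have [Lft _] := Lfun_comp mtau tau_pres Lf.
transitivity (\int[pushforward mu tau]_x (EFin \o f) x)%E.
  rewrite integral_pushforward//.
  - by apply/measurable_EFinP; exact: Lfun_measurable Lf.
  - exact/Lfun1_integrable.
by apply: eq_measure_integral => B mB _; exact: tau_pres.
Qed.

(** As [f] is only integrable, it is first truncated to [g]: the part [f - g] is paired using the
    bound [K] on [v n], and [g] using the L^1 norm of [v n]. *)
Lemma Rintegral_mul_cvg0 f (v : nat -> T -> R) (K : R) : 0 <= K ->
  f \in Lfun mu 1%:E -> (forall n, measurable_fun [set: T] (v n)) ->
  (forall n x, `|v n x| <= K) -> nrm 1 (v n) @[n --> \oo] --> (0 : R) ->
  \int[mu]_x (f x * v n x) @[n --> \oo] --> (0 : R).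
Proof.
move=> K0 Lf mv vK v0; apply/cvgrPdist_le => e e0.
have K1 : 0 < K + 1 by rewrite ltr_wpDl.
have e2 : 0 < e / 2 / (K + 1) by rewrite !divr_gt0.
have [M M0 fM] := clamp_dense (lexx 1) Lf e2.
have M1 : 0 < M + 1 by rewrite ltr_wpDl.
have e2M : 0 < e / 2 / (M + 1) by rewrite !divr_gt0.
pose g x := clamp M (f x).
have mg : measurable_fun [set: T] g by exact/measurable_clamp/Lfun_measurable/Lf.
have gM x : `|g x| <= M by exact: norm_clamp_le.
have Lg := bounded_Lfun mu (lexx 1) mg gM.
move/cvgrPdist_le : v0 => /(_ _ e2M); apply: filterS => n.
rewrite !sub0r !normrN ger0_norm ?nrm_ge0// => v_small.
have Lv := bounded_Lfun mu (lexx 1) (mv n) (vK n).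
have [Lvg Nvg] := nrm1_mul_bounded M0 Lv mg gM.
have [Lfgv Nfgv] := nrm1_mul_bounded K0 (LfunB (lexx 1) Lf Lg) (mv n) (vK n).
rewrite (_ : (fun x => f x * v n x) = ((f \- g) \* v n) \+ (v n \* g)); last first.
  by apply/funext => x /=; ring.
apply: le_trans (norm_Rintegral_le (LfunD (lexx 1) Lfgv Lvg)) _.
apply: le_trans (nrmD (lexx 1) Lfgv Lvg) _.
have le_e2 (C N : R) : 0 <= C -> 0 <= N -> N <= e / 2 / (C + 1) -> C * N <= e / 2.
  move=> C0 N0; rewrite ler_pdivlMr ?ltr_wpDl// => h.
  by apply: le_trans h; rewrite mulrC ler_wpM2l// lerDl.
have h1 := le_trans Nfgv (le_e2 _ _ K0 (nrm_ge0 _ _ _) fM).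
have h2 := le_trans Nvg (le_e2 _ _ M0 (nrm_ge0 _ _ _) v_small).
lra.
Qed.

End L1Pairing.

(** * Cocycles up to null sets *)

Section AeCocycles.
Context (R : realType) (d : measure_display) (T : measurableType d).
Context (mu : probability T R) (G : groupType) (A : mp_action G mu).
Implicit Types (f u : T -> R) (g h : G).
Local Notation nrm := (nrm mu).
Local Notation kp := (koopman A).

Lemma koopman1 f : kp 1%g f = f.
Proof. by apply/funext => x; rewrite /koopman invg1 act1. Qed.

Lemma koopmanM g h f : kp (g * h)%g f = kp g (kp h f).
Proof. by apply/funext => x; rewrite /koopman invgM actM. Qed.

(** Identifies [avg n f] along [A z^-1] with the mean of the translates of [f] by [z ^+ k],
    [k <= n]. *)
Lemma koopmanX g k f : kp (g ^+ k)%g f = f \o iter k (A g^-1%g).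
Proof.
elim: k f => [|k IH] f; first by rewrite expg0 koopman1.
by rewrite expgSr koopmanM IH; apply/funext => x.
Qed.

Lemma Lfun_koopman (r : R) g f : f \in Lfun mu r%:E ->
  kp g f \in Lfun mu r%:E /\ nrm r (kp g f) = nrm r f.
Proof.
move=> Lf; apply: (Lfun_comp (act_measurable A g^-1%g)) => // B mB.
exact: act_preserving.
Qed.

Lemma koopman_ae_eq g f u : f = u %[ae mu] -> kp g f = kp g u %[ae mu].
Proof.
move=> [N [mN N0 fuN]]; exists (A g^-1%g @^-1` N); split.
- by rewrite -[_ @^-1` _]setTI; exact: act_measurable.
- by rewrite act_preserving.
by move=> x nfu; apply: fuN => /= fu; apply: nfu => _; exact: fu.
Qed.

(** The identity is on functions instead of classes; the exceptional null set may depend on [g] and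
    [h]. *)
Definition ae_cocycle (beta : G -> T -> R) : Prop :=
  forall g h, beta (g * h)%g = beta g \+ kp g (beta h) %[ae mu].

Section Cocycle.
Context (r : R) (r1 : 1 <= r) (beta : G -> T -> R).
Context (Lbeta : forall g, beta g \in Lfun mu r%:E) (cb : ae_cocycle beta).

Lemma ae_cocycle1 : beta 1%g = (fun=> 0) %[ae mu].
Proof.
have := cb 1%g 1%g; rewrite mulg1 koopman1; apply: filterS => x /= + _ => /(_ I).
by move=> /eqP; rewrite -subr_eq subrr => /eqP.
Qed.

Lemma ae_cocycleV g : beta g^-1%g = (fun x => - kp g^-1%g (beta g) x) %[ae mu].
Proof.
have := cb g^-1%g g; rewrite mulVg; apply: filterS2 ae_cocycle1 => x /= + + _.
by move=> /(_ I) -> /(_ I) /eqP; rewrite eq_sym addr_eq0 => /eqP.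
Qed.

Lemma nrm_cocycle1 : nrm r (beta 1%g) = 0.
Proof. by rewrite (eq_ae_nrm (Lbeta _) (Lfun0 mu r) ae_cocycle1) nrm0. Qed.

Lemma nrm_cocycleM g h : nrm r (beta (g * h)%g) <= nrm r (beta g) + nrm r (beta h).
Proof.
have [Lk <-] := Lfun_koopman g (Lbeta h).
by rewrite (eq_ae_nrm (Lbeta _) (LfunD r1 (Lbeta g) Lk) (cb g h)) nrmD.
Qed.

Lemma nrm_cocycleV g : nrm r (beta g^-1%g) = nrm r (beta g).
Proof.
have [Lk ek] := Lfun_koopman g^-1%g (Lbeta g).
have h : beta g^-1%g = (-1) \*: kp g^-1%g (beta g) %[ae mu].
  by apply: filterS (ae_cocycleV g) => x /= + _ => /(_ I) ->; rewrite scaleN1r.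
by rewrite (eq_ae_nrm (Lbeta _) (LfunZ r1 (-1) Lk) h) nrmZ// normrN1 mul1r ek.
Qed.

Lemma nrm_cocycle_le_word_length (S : seq G) (genS : generates S) (e : R) :
  (forall s, s \in S -> nrm r (beta s) <= e) ->
  forall g, nrm r (beta g) <= e * (word_length genS g)%:R.
Proof.
apply: subadditive_word_length; first by rewrite nrm_cocycle1.
- exact: nrm_cocycleM.
- exact: nrm_cocycleV.
Qed.

(** The values on powers are Birkhoff sums; hence [avg m (beta g)] along [A g^-1] is
    [beta (g ^+ m.+1)] divided by [m + 1]. *)
Lemma ae_cocycleX g k :
  beta (g ^+ k)%g = (fun x => \sum_(j < k) beta g (iter j (A g^-1%g) x)) %[ae mu].
Proof.
elim: k => [|k IH].
  apply: filterS ae_cocycle1 => x /= + _ => /(_ I).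
  by rewrite big_ord0 expg0.
have := cb (g ^+ k)%g g; rewrite -expgSr koopmanX; apply: filterS2 IH => x /= + + _.
by move=> /(_ I) e1 /(_ I) ->; rewrite big_ord_recr /= e1.
Qed.

End Cocycle.

Lemma ae_cocycleB (beta gamma : G -> T -> R) : ae_cocycle beta ->
  ae_cocycle gamma -> ae_cocycle (fun g => beta g \- gamma g).
Proof.
move=> cb cg g h; apply: filterS2 (cb g h) (cg g h) => x /= + + _.
by move=> /(_ I) -> /(_ I) ->; rewrite /koopman /=; ring.
Qed.

(** * Averaging a cocycle along a central element *)

Section CentralAverages.
Context (z : G) (z_central : forall g, commute z g).
Local Notation tau := (A z^-1%g).
Local Notation avg := (avg tau).
Let mtau : measurable_fun [set: T] tau := act_measurable A z^-1%g.
Let tau_pres B (mB : measurable B) : mu (tau @^-1` B) = mu B :=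
  act_preserving A z^-1%g mB.

(** Centrality of [z] enters here: averaging along [z] commutes with the representation, so it maps
    cocycles to cocycles. *)
Lemma avg_koopman n g f : avg n (kp g f) = kp g (avg n f).
Proof.
apply/funext => x; rewrite /koopman /avg; congr (_ * _).
apply: eq_bigr => k _; congr (f _).
elim: (k : nat) => [//|j /= IH].
by rewrite -IH -!actM -!invgM z_central.
Qed.

Lemma avg_ae_eq n f u : f = u %[ae mu] -> avg n f = avg n u %[ae mu].
Proof.
move=> fu.
have /filter_forall : forall k : 'I_n.+1,
    \forall x \ae mu, f (iter k tau x) = u (iter k tau x).
  move=> k; have := koopman_ae_eq (z ^+ k)%g fu; rewrite !koopmanX.
  by apply: filterS => x /= /(_ I).
apply: filterS => x fux _; congr (_ * _).
by apply: eq_bigr => k _.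
Qed.

Lemma ae_cocycle_avg n (beta : G -> T -> R) : ae_cocycle beta ->
  ae_cocycle (fun g => avg n (beta g)).
Proof.
move=> cb g h; have := avg_ae_eq n (cb g h).
by rewrite avgD avg_koopman.
Qed.

Section Bound.
Context (r : R) (r1 : 1 <= r) (beta : G -> T -> R).
Context (Lbeta : forall g, beta g \in Lfun mu r%:E) (cb : ae_cocycle beta).

(** The function w_n whose coboundary is the difference between the averaged cocycle and [beta]. *)
Definition primitive n : T -> R :=
  fun x => n.+1%:R^-1 * \sum_(k < n.+1) beta (z ^+ k)%g x.

Lemma Lfun_primitive n : primitive n \in Lfun mu r%:E.
Proof.
apply: (LfunZ r1 n.+1%:R^-1).
exact: (@Lfun_sum _ _ _ mu r r1 _ _ (fun k : 'I_n.+1 => beta (z ^+ k)%g)).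
Qed.

(* Since [z] is central, [beta z^k + pi(z^k) beta g = beta g + pi(g) beta z^k]. *)
Lemma avg_cocycleE n g :
  avg n (beta g) = beta g \+ (kp g (primitive n) \- primitive n) %[ae mu].
Proof.
have /filter_forall : forall k : 'I_n.+1, \forall x \ae mu,
    beta g (iter k tau x) = beta g x + kp g (beta (z ^+ k)%g) x - beta (z ^+ k)%g x.
  move=> k; have ck : commute (z ^+ k)%g g.
    by apply: commute_sym; apply: commuteX; exact/commute_sym.
  have := cb (z ^+ k)%g g; rewrite ck koopmanX; apply: filterS2 (cb g (z ^+ k)%g) => x /= + +.
  by move=> /(_ I) -> /(_ I) ->; rewrite addrC addKr.
apply: filterS => x h _; rewrite /avg (eq_bigr _ (fun k _ => h k)).
rewrite sumrB big_split /= sumr_const card_ord !mulrBr mulrDr.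
rewrite -[X in _ * X + _ - _]mulr_natl mulKf ?pnatr_eq0// /primitive /koopman /=.
by rewrite addrA.
Qed.

(** The representation is isometric, so the coboundary of [primitive n] is bounded uniformly in
    [g]. *)
Lemma nrm_cocycle_le_avg n g :
  nrm r (beta g) <= nrm r (avg n (beta g)) + 2 * nrm r (primitive n).
Proof.
have Lw := Lfun_primitive n; have [Lkw ekw] := Lfun_koopman g Lw.
have La := Lfun_avg mtau tau_pres r1 n (Lbeta g).
have Ld := LfunB r1 Lkw Lw.
have e : beta g = avg n (beta g) \- (kp g (primitive n) \- primitive n) %[ae mu].
  by apply: filterS (avg_cocycleE n g) => x /= + _ => /(_ I) ->; rewrite addrK.
rewrite (eq_ae_nrm (Lbeta g) (LfunB r1 La Ld) e).
rewrite (le_trans (nrmB r1 La Ld))// lerD2l (le_trans (nrmB r1 Lkw Lw))//.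
by rewrite ekw; lra.
Qed.

End Bound.

End CentralAverages.
End AeCocycles.

(** * Averages over a central element of the derived subgroup *)

Section DerivedCentral.
Context (R : realType) (d : measure_display) (T : measurableType d).
Context (mu : probability T R) (G : groupType) (A : mp_action G mu).
Context (z : G) (z_central : forall g, commute z g) (z_derived : derived_subgroup G z).
Local Notation nrm := (nrm mu).
Local Notation kp := (koopman A).
Local Notation tau := (A z^-1%g).
Local Notation avg := (avg tau).
Let mtau : measurable_fun [set: T] tau := act_measurable A z^-1%g.
Let tau_pres B (mB : measurable B) : mu (tau @^-1` B) = mu B :=
  act_preserving A z^-1%g mB.
Let l11 : 1 <= 1 :> R := lexx 1.

(** * Exponent 1: pairing a cocycle with truncated averages *)

Section L1.
Context (beta : G -> T -> R).
Context (Lbeta : forall g, beta g \in Lfun mu 1%:E) (cb : ae_cocycle A beta).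

(** Truncation makes [u n] bounded, so that it can be paired with integrable functions. *)
Let u n x := clamp 1 (avg n (beta z) x).
Let phi n g := \int[mu]_x (beta g x * u n x).

Let La n g : avg n (beta g) \in Lfun mu 1%:E.
Proof. exact: Lfun_avg. Qed.

Let mu_ n : measurable_fun [set: T] (u n).
Proof. exact/measurable_clamp/Lfun_measurable/(La n z). Qed.

Let u1 n x : `|u n x| <= 1.
Proof. exact: norm_clamp_le. Qed.

Let Lmul f n : f \in Lfun mu 1%:E -> f \* u n \in Lfun mu 1%:E.
Proof. by move=> Lf; have [] := nrm1_mul_bounded ler01 Lf (mu_ n) (u1 n). Qed.

(** [clamp 1] is 1-Lipschitz and commutes with translations, which reduces the claim to
    [avg n (kp g (beta z) \- beta z)]. As [g] and [z] commute, this is the average of a coboundary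
    along [z], of order [1 / n]. *)
Let almost_invariant g : nrm 1 (kp g (u n) \- u n) @[n --> \oo] --> (0 : R).
Proof.
pose C := 2 * nrm 1 (beta g).
have C0 : (fun n => C * harmonic n) @ \oo --> (0 : R).
  by rewrite -[X in _ --> X](mulr0 C); apply: cvgM; [exact: cvg_cst|exact: cvg_harmonic].
apply: (squeeze_cvgr _ (cvg_cst 0) C0); apply: nearW => n; rewrite nrm_ge0 /=.
have [Lkz _] := Lfun_koopman A g (Lbeta z).
have [Lzk _] := Lfun_koopman A z (Lbeta g).
have Ld := LfunB l11 Lzk (Lbeta g).
have mku : measurable_fun [set: T] (kp g (u n)).
  exact: measurableT_comp (mu_ n) (act_measurable A g^-1%g).
have Lk := LfunB l11 Lkz (Lbeta z).
apply: (@le_trans _ _ (nrm 1 (avg n (kp g (beta z) \- beta z)))).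
  apply: (ler_nrm l11 _ (Lfun_avg mtau tau_pres l11 n Lk) _).2.
    exact: measurable_funB.
  move=> x; rewrite avgB avg_koopman//; exact: clamp_lip.
(* Averaging this coboundary along [z] kills it. *)
have e : kp g (beta z) \- beta z = kp z (beta g) \- beta g %[ae mu].
  have := cb g z; rewrite -z_central; apply: filterS2 (cb z g) => x /= + + _.
  by move=> /(_ I) -> /(_ I) => h; lra.
rewrite (eq_ae_nrm (Lfun_avg mtau tau_pres l11 n Lk)
  (Lfun_avg mtau tau_pres l11 n Ld) (avg_ae_eq A z n e)).
rewrite avgB; exact: nrm_avg_tau.
Qed.

(** The defect equals the pairing of [beta h] with [kp g^-1 (u n) \- u n], which tends to 0 by
    almost invariance. *)
Let phi_hom g h : phi n (g * h)%g - (phi n g + phi n h) @[n --> \oo] --> (0 : R).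
Proof.
rewrite (_ : (fun n => _) = (fun n => \int[mu]_x (beta h x * (kp g^-1%g (u n) \- u n) x))).
  apply: (@Rintegral_mul_cvg0 _ _ _ _ (beta h)
    (fun n => kp g^-1%g (u n) \- u n) 2 _ _ _ _ (almost_invariant _)) => //.
  - move=> n; apply: measurable_funB => //.
    exact: measurableT_comp (mu_ n) (act_measurable A g^-1^-1%g).
  - move=> n x /=; rewrite (le_trans (ler_normB _ _))//.
    by have := u1 n x; have := u1 n (A g^-1^-1%g x); rewrite /koopman; lra.
apply/funext => n.
have [Lk _] := Lfun_koopman A g (Lbeta h).
have Lku : beta h \* kp g^-1%g (u n) \in Lfun mu 1%:E.
  have [] // := nrm1_mul_bounded ler01 (Lbeta h) _ (_ : forall x, `|kp g^-1%g (u n) x| <= 1).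
    exact: measurableT_comp (mu_ n) (act_measurable A g^-1^-1%g).
  by move=> x; exact: u1.
have -> : phi n (g * h)%g = phi n g + \int[mu]_x (beta h x * kp g^-1%g (u n) x).
  transitivity (\int[mu]_x ((beta g x * u n x) + (kp g (beta h) x * u n x))).
    apply: ae_eq_Rintegral; [exact: Lmul|exact: (LfunD l11 (Lmul n (Lbeta g)) (Lmul n Lk))|].
    by apply: filterS (cb g h) => x /= + _ => /(_ I) ->; rewrite mulrDl.
  rewrite (RintegralD1 (Lmul n (Lbeta g)) (Lmul n Lk)); congr (_ + _).
  (* Invariance of the measure moves the translation from [beta h] to [u n]. *)
  have := Rintegral_comp (act_measurable A g^-1%g)
    (fun B mB => act_preserving A g^-1%g mB) Lku.
  move=> <-; apply: eq_Rintegral => x _; rewrite /koopman /=.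
  by rewrite -actM mulVg act1.
rewrite opprD addrACA subrr add0r.
rewrite -(RintegralB1 Lku (Lmul n (Lbeta h))).
by apply: eq_Rintegral => x _ /=; rewrite mulrBr.
Qed.

Let phi_z k : phi n (z ^+ k)%g @[n --> \oo] --> (0 : R).
Proof.
apply: (derived_subgroup_asymptotic_hom phi_hom) => P gP ged.
have zP : z \in P by exact: z_derived.
elim: k => [|k IH]; first by rewrite expg0; case: gP.
by rewrite expgS; exact: group_closedM.
Qed.

(** By the mean ergodic theorem a fixed [m] can replace [n] in the average at cost [e / 2]. Then
    [avg m (beta z)] is [beta (z ^+ m.+1)] over [m + 1], whose pairing with [u n] tends to 0 as [n]
    grows. *)
Let pairing_cvg0 : \int[mu]_x (avg n (beta z) x * u n x) @[n --> \oo] --> (0 : R).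
Proof.
apply/cvgrPdist_le => e e0; have e2 : 0 < e / 2 by rewrite divr_gt0.
have [m mP] := avg_cauchy mtau tau_pres l11 (Lbeta z) e2.
have : m.+1%:R^-1 * phi n (z ^+ m.+1)%g @[n --> \oo] --> (0 : R).
  by rewrite -[X in _ --> X](mulr0 m.+1%:R^-1); apply: cvgM; [exact: cvg_cst|exact: phi_z].
move=> /cvgrPdist_le /(_ _ e2); apply: filterS2 (nbhs_infty_ge m) => n mn.
rewrite !sub0r !normrN => hphi.
have Ld := LfunB l11 (La n z) (La m z).
have e1 : \int[mu]_x (avg m (beta z) x * u n x) = m.+1%:R^-1 * phi n (z ^+ m.+1)%g.
  rewrite -RintegralZl//; last exact/Lfun1_integrable/(Lmul n (Lbeta _)).
  apply: ae_eq_Rintegral; first exact: Lmul.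
    exact: (LfunZ l11 m.+1%:R^-1 (Lmul n (Lbeta (z ^+ m.+1)%g))).
  apply: filterS (ae_cocycleX cb z m.+1) => x /= + _ => /(_ I) ->.
  by rewrite mulrA.
have -> : \int[mu]_x (avg n (beta z) x * u n x) =
    \int[mu]_x ((avg n (beta z) \- avg m (beta z)) x * u n x) +
    \int[mu]_x (avg m (beta z) x * u n x).
  rewrite -(RintegralD1 (Lmul n Ld) (Lmul n (La m z))).
  by apply: eq_Rintegral => x _ /=; rewrite -mulrDl subrK.
rewrite e1 (le_trans (ler_normD _ _))// [leRHS](splitr e) lerD//.
apply: le_trans (norm_Rintegral_le (Lmul n Ld)) _.
have [_] := nrm1_mul_bounded ler01 Ld (mu_ n) (u1 n).
by rewrite mul1r => /le_trans; apply; exact: mP.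
Qed.

Lemma nrm1_avg_cvg0 : nrm 1 (avg n (beta z)) @[n --> \oo] --> (0 : R).
Proof.
apply/cvgrPdist_le => e e0.
(* [t <= 1] serves the pointwise inequality, [t <= e / 2] the constant term of its integral. *)
pose t := Num.min 1 (e / 2).
have t0 : 0 < t by rewrite lt_min ltr01 divr_gt0.
have t1 : t <= 1 by rewrite ge_min lexx.
have te : t <= e / 2 by rewrite ge_min lexx orbT.
have te2 : 0 < t * (e / 2) by rewrite mulr_gt0// divr_gt0.
move/cvgrPdist_le : pairing_cvg0 => /(_ _ te2); apply: filterS => n.
rewrite !sub0r !normrN (ger0_norm (nrm_ge0 _ _ _)) => /(le_trans (ler_norm _)) h.
have Lu := Lmul n (La n z).
have Lct : (fun=> t) \in Lfun mu 1%:E by exact: Lfun_cst.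
(* [|y| <= t + y (clamp 1 y) / t] for [0 < t <= 1]. *)
apply: (@le_trans _ _ (t + t^-1 * \int[mu]_x (avg n (beta z) x * u n x))).
  have LZ := LfunZ l11 t^-1 Lu.
  have -> : t + t^-1 * \int[mu]_x (avg n (beta z) x * u n x) =
      \int[mu]_x ((fun=> t) x + (t^-1 \*: (avg n (beta z) \* u n)) x).
    rewrite RintegralD1//; congr (_ + _).
      rewrite Rintegral_cst// -[LHS]mulr1; congr (_ * _).
      exact/esym/(congr1 fine (probability_setT mu)).
    by rewrite -RintegralZl//; exact/Lfun1_integrable.
  rewrite nrm1E//.
  apply: le_Rintegral => //.
  - exact/Lfun1_integrable/Lfun_norm.
  - exact/Lfun1_integrable/(LfunD l11 Lct (LfunZ l11 t^-1 Lu)).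
  move=> x _ /=; rewrite /GRing.scale /= /u.
  set y := avg n (beta z) x.
  rewrite -lerBlDl ler_pdivlMl//.
  case: (clampP y ler01) => -[hy ->]; case: (ger0P y) => ?; nra.
have : t^-1 * \int[mu]_x (avg n (beta z) x * u n x) <= e / 2 by rewrite ler_pdivrMl.
lra.
Qed.

End L1.

(** * General exponent and the linear bound on powers of [z] *)

Section Lr.
Context (r : R) (r1 : 1 <= r) (beta : G -> T -> R).
Context (Lbeta : forall g, beta g \in Lfun mu r%:E) (cb : ae_cocycle A beta).

(** The value at [z] passes from L^1 to L^r; powers follow because the averaged maps are cocycles
    and their norms are subadditive. *)
Lemma nrm_avg_central_cvg0 k : nrm r (avg n (beta (z ^+ k)%g)) @[n --> \oo] --> (0 : R).
Proof.
have Lab n g := Lfun_avg mtau tau_pres r1 n (Lbeta g).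
have cab n := ae_cocycle_avg z_central n cb.
elim: k => [|k IH].
  rewrite expg0; apply: cvg_near_cst; apply: nearW => n.
  exact: nrm_cocycle1 (Lab n) (cab n).
have z0 : nrm r (avg n (beta z)) @[n --> \oo] --> (0 : R).
  apply: avg_cvg0_nrm1 => //; apply: nrm1_avg_cvg0 => // g.
  exact: Lfun_Lfun1 (Lbeta g).
have s0 : nrm r (avg n (beta z)) + nrm r (avg n (beta (z ^+ k)%g)) @[n --> \oo] --> (0 : R).
  by rewrite -[X in _ --> X](addr0 0); exact: cvgD.
apply: (squeeze_cvgr _ (cvg_cst 0) s0); apply: nearW => n.
rewrite nrm_ge0 expgS /=.
exact: (nrm_cocycleM r1 (Lab n) (cab n)).
Qed.

Lemma cocycle_sublinear (S : seq G) (genS : generates S) (e : R) : 0 < e ->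
  exists C : R, forall c, (exists k, c = z ^+ k \/ c = z ^- k)%g ->
    nrm r (beta c) <= C + e * (word_length genS c)%:R.
Proof.
move=> e0.
have Lab n g := Lfun_avg mtau tau_pres r1 n (Lbeta g).
have cab n := ae_cocycle_avg z_central n cb.
(* One [n] serves all generators, as the maximum over a finite list. *)
have [n nP] : exists n, forall s, s \in S -> forall m, (n <= m)%N ->
    nrm r (avg n (beta s) \- avg m (beta s)) <= e.
  suff [n nP] : exists n, forall s, s \in S -> forall m m', (n <= m)%N -> (n <= m')%N ->
      nrm r (avg m (beta s) \- avg m' (beta s)) <= e.
    by exists n => s sS m nm; exact: nP.
  elim: (S) => [|s S' [n nP]]; first by exists 0%N.
  have [n' n'P] := avg_cauchy mtau tau_pres r1 (Lbeta s) e0.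
  exists (maxn n n') => t; rewrite in_cons => /orP[/eqP ->|tS] m m'; rewrite !geq_max.
    by move=> /andP[_ h] /andP[_ h']; exact: n'P.
  by move=> /andP[h _] /andP[h' _]; exact: nP.
(* The constant depends on [e] through [n], but not on [c]. *)
exists (2 * nrm r (primitive z beta n)) => c zc.
rewrite (le_trans (nrm_cocycle_le_avg z_central r1 Lbeta cb n c))// addrC lerD2l.
have cvg_c : nrm r (avg m (beta c)) @[m --> \oo] --> (0 : R).
  case: zc => k [->|->]; first exact: nrm_avg_central_cvg0.
  rewrite (_ : (fun m => _) = (fun m => nrm r (avg m (beta (z ^+ k)%g)))).
    exact: nrm_avg_central_cvg0.
  by apply/funext => m; exact: (nrm_cocycleV r1 (Lab m) (cab m)).
(* The difference of the two averaged cocycles is a cocycle of norm at most [e] on generators, hence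
   at most [e] times the word length at [c]. The last term vanishes as [m] grows. *)
have le_m m : (n <= m)%N -> nrm r (avg n (beta c)) <=
    e * (word_length genS c)%:R + nrm r (avg m (beta c)).
  move=> nm.
  have := nrm_cocycle_le_word_length r1 (fun g => LfunB r1 (Lab n g) (Lab m g))
    (ae_cocycleB (cab n) (cab m)) genS (fun s sS => nP s sS m nm) c.
  have := nrmD r1 (LfunB r1 (Lab n c) (Lab m c)) (Lab m c).
  rewrite (_ : _ \+ _ = avg n (beta c)); last by apply/funext => x /=; rewrite subrK.
  lra.
apply: (@ler_cvg_to nat \oo _ R (fun=> nrm r (avg n (beta c)))
  (fun m => e * (word_length genS c)%:R + nrm r (avg m (beta c)))).
- exact: cvg_cst.
- by rewrite -[X in _ --> X]addr0; apply: cvgD => //; exact: cvg_cst.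
- by exists n.
Qed.

End Lr.
End DerivedCentral.

(** * Passage from L^p classes to functions and from [C] to powers of one element *)

Lemma cocycle_ae (R : realType) (d : measure_display) (T : measurableType d)
    (mu : probability T R) (p : R) (p1 : (1 <= p%:E)%E) (G : groupType)
    (A : mp_action G mu) (b : G -> LspaceType mu p1) :
  cocycle A b -> ae_cocycle A (fun g => Lp_repr (b g)).
Proof.
move=> cb g h; rewrite cb.
apply: ae_eq_trans (Lp_classE _) _.
have := Lp_classE (koopman A g (Lp_repr (b h)) : LfunType mu p1).
apply: filterS => x e _; exact: (congr1 (+%R (Lp_repr (b g) x)) (e I)).
Qed.

Lemma isomorphic_to_Z_cyclic (C : groupType) : isomorphic_to_Z C ->
  exists z : C, forall c, exists k, (c = z ^+ k \/ c = z ^- k)%g.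
Proof.
move=> [f [f' f'K fK] fD]; exists (f 1%R) => c.
have f0 : f 0 = 1%g.
  by apply: (mulgI (f 0)); rewrite mulg1 -fD addr0.
have fn (n : nat) : f n%:Z = (f 1%R ^+ n)%g.
  elim: n => [|n IH]; first by rewrite expg0.
  by rewrite -addn1 PoszD fD IH addn1 -expgSr.
rewrite -(fK c); case: (f' c) => n; first by exists n; left.
(* [Negz n] stands for [-(n + 1)]. *)
exists n.+1; right; apply: (mulgI (f n.+1%:Z)).
by rewrite -fD NegzE addrN f0 fn mulgV.
Qed.

Lemma multiplicative_powers (H K : groupType) (f : {multiplicative H -> K}) x k :
  f (x ^+ k)%g = (f x ^+ k)%g /\ f (x ^- k)%g = (f x ^- k)%g.
Proof.
have f1 : f 1%g = 1%g by apply: (mulgI (f 1%g)); rewrite -gmulfM !mulg1.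
have fX : f (x ^+ k)%g = (f x ^+ k)%g.
  by elim: k => [|k IH]; rewrite ?expg0// !expgS gmulfM IH.
by split=> //; apply: (mulgI (f x ^+ k)%g); rewrite -{1}fX -gmulfM !mulgV.
Qed.

Theorem proposition1p4 (C E G : groupType)
    (i : {multiplicative C -> E}) (q : {multiplicative E -> G})
    (extension : central_extension i q)
    (C_Z : isomorphic_to_Z C)
    (C_derived : range i `<=` derived_subgroup E)
    (S : seq E) (genS : generates S)
    (R : realType) (d : measure_display) (Omega : measurableType d)
    (nu : probability Omega R) (Omega_standard : standard_borel R Omega)
    (A : mp_action E nu)
    (p : R) (p1 : (1 <= p%:E)%E)
    (b : E -> LspaceType nu p1) (b_cocycle : cocycle A b) :
  Lp_norm (b (i c)) / (word_length genS (i c))%:R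
    @[c --> at_infinity (fun c => word_length genS (i c))] --> (0 : R).
Proof.
have [z0 z0P] := isomorphic_to_Z_cyclic C_Z.
pose len c := word_length genS (i c).
have FF : Filter (at_infinity len).
  apply: filter_fromT_filter; first by exists 0%N.
  move=> m n; exists (maxn m n) => c /=; rewrite geq_max => /andP[? ?]; split=> //.
apply/cvgrPdist_le => e e0; have e2 : 0 < e / 2 by rewrite divr_gt0.
have [K KP] := cocycle_sublinear (cext_central extension z0)
  (C_derived _ (imageT i z0)) p1 (fun g => LfunP (Lp_repr (b g)))
  (cocycle_ae b_cocycle) genS e2.
(* From length [N] on, half of [e] times the length absorbs the constant [K]; [0 < N] makes the
   division by the length legitimate. *)
have [N N0 KN] : exists2 N, (0 < N)%N & K <= e / 2 * N%:R.
  have [N _ h] := nbhs_infty_ger (K / (e / 2)).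
  exists N.+1 => //; rewrite mulrC -ler_pdivrMr//; apply: h => /=; exact: leqnSn.
exists N => // c /= Nc.
have l0 : 0 < (word_length genS (i c))%:R :> R by rewrite ltr0n (leq_trans N0).
rewrite sub0r normrN ger0_norm ?divr_ge0 ?ler0n//; last exact: nrm_ge0.
rewrite ler_pdivrMr//.
have zc : exists k, (i c = i z0 ^+ k \/ i c = i z0 ^- k)%g.
  have [k kP] := z0P c; exists k.
  have [eX eV] := multiplicative_powers i z0 k.
  by case: kP => ->; [left|right].
have := KP (i c) zc.
rewrite (_ : nrm _ _ _ = Lp_norm (b (i c)))// => /le_trans; apply.
apply: (@le_trans _ _ (e / 2 * (word_length genS (i c))%:R +
                       e / 2 * (word_length genS (i c))%:R)).
  rewrite lerD2r (le_trans KN)//.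
  by apply: ler_wpM2l; [exact: ltW|rewrite ler_nat].
by rewrite -mulrDl -splitr.
Qed.
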